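(* Let $x_1,x_2,\dots$ be independent (not necessarily identically distributed) random variables with values in $\{0,1\}$, and put $p_{i;0}:=\mathbb{P}[x_i=0]$. Suppose $p_{i;0}>0$ and $p_{i;0}\neq 0.5$ for every $i\ge1$. Let $X=\sum_{i=1}^\infty x_i2^{-i}$ and $F(x)=\mathbb{P}[X\le x]$. If the sequence $(p_{i;0})_{i\ge 1}$ does not converge to $0.5$, then $F'(x)=0$ for Lebesgue-almost every $x\in[0,1]$, and therefore $F$ is singular.
   Context: The random variable $x_i$ models the flip of the $i$-th coin, each coin having its own weighting. A distribution function $F$ on $[0,1]$ is called singular if the associated probability measure is concentrated on a set of Lebesgue measure zero; equivalently, $F'(x)=0$ for Lebesgue-almost every $x\in[0,1]$. *)

(* Defs.v *)
From HB Require Import structures.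
From mathcomp Require Import all_boot all_order all_algebra.
From mathcomp Require Import all_classical all_reals all_analysis.
From mathcomp Require Import measurable_realfun.
Set Implicit Arguments.
Unset Strict Implicit.
Unset Printing Implicit Defensive.
Import Order.TTheory GRing.Theory Num.Theory.
Import numFieldNormedType.Exports.
Local Open Scope classical_set_scope.
Local Open Scope ring_scope.

Definition mutually_independent (I : eqType) (R : realType)
    (d : measure_display) (T : measurableType d) (P : probability T R)
    (d' : measure_display) (T' : measurableType d')
    (x : I -> {RV P >-> T'}) : Prop :=
  forall (J : seq I) (A : I -> set T'), uniq J ->
    (forall i, i \in J -> measurable (A i)) ->
    P (\big[setI/setT]_(i <- J) (x i @^-1` A i)) =
    (\prod_(i <- J) P (x i @^-1` A i))%E.

(* {0, 1}-valued random variables are modelled as boolean ones, with [false]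
   for 0 and [true] for 1, and sequences start at index 0: the variable of
   index i below is the (i + 1)-st coin, whence the weight 2^-(i + 1). *)

Definition prob0 (R : realType) (d : measure_display) (T : measurableType d)
    (P : probability T R) (x : nat -> {RV P >-> bool}) (i : nat) : R :=
  fine (P (x i @^-1` [set false])).

Definition binary_sum (R : realType) (T : Type) (x : nat -> T -> bool) (t : T)
    : R :=
  limn (series (fun i => (x i t)%:R * 2 ^- i.+1 : R)).

Lemma cvg_binary_sum (R : realType) (T : Type) (x : nat -> T -> bool) (t : T) :
  series (fun i => (x i t)%:R * 2 ^- i.+1 : R) @ \oo --> binary_sum R x t.
Proof.
have cg : cvgn (series (geometric (2^-1 : R) 2^-1)).
  apply: is_cvg_geometric_series.
  by rewrite ger0_norm ?invr_ge0// invf_lt1// ltr1n.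
apply: (series_le_cvg _ _ _ cg) => i /=.
- by rewrite mulr_ge0// invr_ge0 exprn_ge0.
- by rewrite mulr_ge0 ?exprn_ge0 ?invr_ge0.
- rewrite -exprVn -exprS ler_piMl ?exprn_ge0 ?invr_ge0//.
  by case: (x i t); rewrite ?ler01.
Qed.

Lemma measurable_binary_sum (R : realType) (d : measure_display)
    (T : measurableType d) (P : probability T R) (x : nat -> {RV P >-> bool}) :
  measurable_fun setT (binary_sum R x).
Proof.
apply: (@measurable_fun_cvg _ _ _ _
  (fun n t => series (fun i => (x i t)%:R * 2 ^- i.+1 : R) n)); last first.
  by move=> t _; exact: cvg_binary_sum.
move=> n; rewrite /series/=; apply: measurable_sum => i.
apply: measurable_funM => //.
by apply: (@measurableT_comp _ _ _ _ _ _ (fun b : bool => b%:R : R)).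
Qed.

HB.instance Definition _ (R : realType) (d : measure_display)
    (T : measurableType d) (P : probability T R) (x : nat -> {RV P >-> bool}) :=
  isMeasurableFun.Build _ _ _ _ (binary_sum R x) (measurable_binary_sum x).

Definition binary_RV (R : realType) (d : measure_display)
    (T : measurableType d) (P : probability T R) (x : nat -> {RV P >-> bool})
    : {RV P >-> R} := binary_sum R x.

(* [mu] is the probability measure associated with [F]: it is unique, since
   the rays ]-oo, r] generate the Borel sets. *)
Definition singular_df (R : realType) (F : R -> R) : Prop :=
  exists mu : probability R R,
    (forall r, mu [set` `]-oo, r]] = (F r)%:E) /\
    exists N : set R,
      [/\ measurable N, lebesgue_measure N = 0%E & mu N = 1%E].

(* Main.v *)
Require Import Defs.
From mathcomp Require Import all_boot all_order all_algebra finmap ring lra.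
From mathcomp Require Import all_classical all_reals all_analysis.
From mathcomp Require Import measurable_realfun.
Import Order.TTheory GRing.Theory Num.Theory.
Import numFieldNormedType.Exports.
Local Open Scope classical_set_scope.
Local Open Scope ring_scope.

(** The law [mu] of the sum is compared with the Lebesgue measure [lambda], which is
    what the law would be if all coins were fair. Among the words of length [n],
    the Hellinger affinity of the two product weights is the product over [i < n]
    of the numbers [sqrt (p_i / 2) + sqrt ((1 - p_i) / 2)]. Each of them is at most
    [1 - (p_i - 1/2) ^+ 2 / 2] ([coin_affinity_le]), so the product gets
    arbitrarily small as soon as [p_i] stays away from 1/2 for infinitely many
    [i]. A small affinity separates the words into those that are unlikely for
    the given coins and those that are few in number; turned into dyadic
    intervals, the latter give closed sets [C] with both [lambda C] and
    [mu (~` C)] as small as wanted ([law_nearly_concentrated]).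

    Such sets yield both conclusions. Their limit superior, for summable
    tolerances, is a [lambda]-null set that carries [mu]
    ([nearly_concentrated_null_carrier]). As for the derivative, the maximal
    inequality [lebesgue_measure_cover_heavy_balls], applied in the open set
    [~` C], says that the points of [~` C] near which [mu] is not small compared
    to [lambda] have a measure controlled by [mu (~` C)]; letting the tolerance
    go to 0, the symmetric intervals around almost every point have vanishing
    [mu]-density, so that the difference quotients of [F] tend to 0
    ([nearly_concentrated_derivative0]). *)

(** * Measures nearly concentrated on Lebesgue-small sets *)

Definition heavy_balls {R : realType} (mu : set R -> \bar R) (c : R)
    (U : set R) : set (R * {posnum R}) :=
  [set i | ball i.1 i.2%:num `<=` U /\
           (c%:E * lebesgue_measure (ball i.1 i.2%:num)
             < mu (ball i.1 i.2%:num))%E].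

(** This is the weak type (1,1) inequality for the maximal function of [mu]. A
    compact part of the union is covered by finitely many heavy balls, among
    which the covering lemma of Vitali selects disjoint ones whose threefold
    enlargements still cover; disjointness inside [U] bounds the sum of their
    [mu]-measures by [mu U]. *)
Lemma lebesgue_measure_cover_heavy_balls (R : realType)
    (mu : {measure set R -> \bar R}) (c : R) (U : set R) :
  0 < c -> open U ->
  (lebesgue_measure
     (cover (heavy_balls mu c U) (fun i => ball i.1 i.2%:num))
   <= (3 / c)%:E * mu U)%E.
Proof.
move=> c0 oU; set V := heavy_balls mu c U.
pose B (i : R * {posnum R}) := ball i.1 i.2%:num.
have oW : open (cover V B) by apply: bigcup_open => i _; exact: ball_open.
rewrite lebesgue_regularity_inner_sup; last exact: open_measurable.
apply: ge_ereal_sup => _ /= [K [cK KW] <-].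
have [D DV KD] : finite_subset_cover V B K.
  move: cK; rewrite compact_cover; apply => // i _; exact: ball_open.
have is_ballB i : is_ball (B i) by exact: is_ball_ball.
have Bset0 i : B i !=set0 by exists i.1; exact: ballxx.
have [E [uE ED tE DE]] := @vitali_lemma_finite_cover _ _ B is_ballB Bset0 D.
have mB i : measurable (B i) by exact: measurable_ball.
apply: (@le_trans _ _ (3%:E * \sum_(i <- E) lebesgue_measure (B i))%E).
  apply: (@le_trans _ _ (\sum_(i \in [set` E]) lebesgue_measure (3 *` B i))%E).
    apply: (@content_sub_fsum _ _ _ (@lebesgue_measure R)).
    - exact: finite_seq.
    - by move=> i _; rewrite scale_ballE//; exact: measurable_ball.
    - by apply: closed_measurable; apply: compact_closed => //; exact: Rhausdorff.
    - exact: (subset_trans KD DE).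
  rewrite -fsbig_seq// ge0_sume_distrr//; apply: lee_sum => i _.
  by rewrite scale_ballE// !lebesgue_measure_ball ?mulr_ge0// -mulrnAr EFinM.
rewrite EFinM -muleA lee_wpmul2l//.
apply: (@le_trans _ _ (\sum_(i <- E) c^-1%:E * mu (B i))%E).
  rewrite [in leLHS]big_seq [in leRHS]big_seq; apply: lee_sum => i /ED /DV.
  rewrite inE => -[_ /ltW].
  by rewrite -lee_pdivrMl ?invr_gt0// invrK.
rewrite -ge0_sume_distrr// lee_wpmul2l ?lee_fin ?invr_ge0 ?(ltW c0)//.
rewrite fsbig_seq// -measure_fin_bigcup//.
apply: le_measure; rewrite ?inE//.
- apply: fin_bigcup_measurable => [|i _]; [exact: finite_seq|exact: mB].
- exact: open_measurable.
- by apply: bigcup_sub => i /= /ED /DV; rewrite inE => -[].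
Qed.

(** An approximate form of mutual singularity with the Lebesgue measure, which
    can be read off at a finite stage of the coin flipping. Taking [C] closed
    spares the outer regularity of [mu]: the set that [mu] almost ignores is
    open from the start, as the covering argument requires. *)
Definition nearly_concentrated {R : realType} (mu : set R -> \bar R) : Prop :=
  forall e : R, 0 < e -> exists C : set R,
    [/\ closed C, (lebesgue_measure C <= e%:E)%E & (mu (~` C) <= e%:E)%E].

(** The limit superior of closed sets [C n] with summable tolerances works: it is
    Lebesgue-null by Borel-Cantelli, and its complement is a union over [k] of sets
    which are [mu]-null, being contained in all the [~` C n] with [n >= k]. *)
Lemma nearly_concentrated_null_carrier (R : realType) (mu : probability R R) :
  nearly_concentrated mu ->
  exists N : set R, [/\ measurable N, lebesgue_measure N = 0%E & mu N = 1%E].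
Proof.
move=> ncmu.
have e0 n : 0 < 1 / (2 ^ n.+1)%:R :> R by rewrite divr_gt0// ltr0n expn_gt0.
have [C CP] := choice (fun n => ncmu _ (e0 n)).
have mC n : measurable (C n) by apply: closed_measurable; have [] := CP n.
have mlim : measurable (lim_sup_set C).
  by apply: bigcap_measurable => // k _; exact: bigcup_measurable.
exists (lim_sup_set C); split => //.
- apply: lim_sup_set_cvg0 => //.
  apply: (@le_lt_trans _ _ (\sum_(n <oo) (1 / (2 ^ n.+1)%:R)%:E)%E).
    by apply: lee_nneseries => // n _; have [] := CP n.
  by rewrite (le_lt_trans (epsilon_trick0 xpredT ler01))// ltry.
- rewrite -[lim_sup_set C]setCK probability_setC; last exact: measurableC.
  suff -> : mu (~` lim_sup_set C) = 0%E by rewrite sube0.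
  apply: measure_negligible; first exact: measurableC.
  rewrite /lim_sup_set setC_bigcap; apply: negligible_bigcup => k.
  have mU : measurable (~` (\bigcup_(j >= k) C j)).
    by apply: measurableC; exact: bigcup_measurable.
  apply/negligibleP => //; apply/eqP; rewrite -measure_le0.
  apply/lee_addgt0Pr => e e_gt0; rewrite add0e.
  have [N _ Ne] := near_infty_natSinv_expn_lt (PosNum e_gt0).
  apply: (@le_trans _ _ (mu (~` C (maxn N k)))).
    rewrite le_measure ?inE//; first exact: measurableC.
    by apply: subsetC; apply: bigcup_sup; exact: leq_maxr.
  have [_ _ /le_trans] := CP (maxn N k); apply.
  by rewrite lee_fin natrX; apply/ltW/Ne; rewrite /= leqW// leq_maxl.
Qed.

Section distribution_function.
Context (R : realType) (mu : probability R R).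

Let F r := fine (mu [set` `]-oo, r]]).

Lemma distribution_function_increment (a r x y : R) :
  ball a r x -> ball a r y -> `|F y - F x| <= fine (mu (ball a r)).
Proof.
wlog xy : x y / x <= y.
  move=> H; have [|/ltW] := leP x y; first exact: H.
  by move=> yx ax ay; rewrite distrC; exact: H.
move=> ax ay.
have setE : `]-oo, y]%classic `\` `]-oo, x]%classic = `]x, y]%classic.
  apply/seteqP; split=> z /=; rewrite !in_itv/=.
    by move=> [-> /negP]; rewrite -ltNge => ->.
  by move=> /andP[xz ->]; split=> //; apply/negP; rewrite -ltNge.
have subE : `]-oo, y]%classic `&` `]-oo, x]%classic = `]-oo, x]%classic.
  by apply/setIidPr => z /=; rewrite !in_itv/= => /le_trans; exact.
have FE : F y - F x = fine (mu [set` `]x, y]]).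
  rewrite /F -fineB ?fin_num_measure// -setE measureD ?subE//.
  by rewrite -ge0_fin_numE ?fin_num_measure.
rewrite FE ger0_norm ?fine_ge0// fine_le ?fin_num_measure//.
  exact: measurable_ball.
rewrite le_measure ?inE//; first exact: measurable_ball.
move: ax ay; rewrite !ball_itv/= !in_itv/= => /andP[ax _] /andP[_ ya] z/=.
rewrite !in_itv/= => /andP[xz zy].
by rewrite (lt_trans ax xz) (le_lt_trans zy ya).
Qed.

(** If there are difference quotients of [F] above [4 / k.+1] arbitrarily close to
    [r], then for each [n] either [r] lies in the small closed set [C n], or in a
    ball inside [~` C n] on which [mu] exceeds [1 / k.+1] times the Lebesgue
    measure. For fixed [k] both sets have a Lebesgue measure of order [1 / n.+1],
    the second one because [mu (~` C n)] is that small; so the intersection over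
    [n] of their unions is null. *)
Lemma nearly_concentrated_derivative0 : nearly_concentrated mu ->
  {ae @lebesgue_measure R, forall r : R, is_derive r 1 F 0}.
Proof.
move=> ncmu.
have e0 n : 0 < n.+1%:R^-1 :> R by [].
have [C CP] := choice (fun n => ncmu _ (e0 n)).
have oC n : open (~` C n) by apply: closed_openC; have [] := CP n.
pose W k n := cover (heavy_balls mu k.+1%:R^-1 (~` C n))
  (fun i => ball i.1 i.2%:num).
pose E k := \bigcap_n (C n `|` W k n).
have mC n : measurable (C n) by apply: closed_measurable; have [] := CP n.
have mW k n : measurable (W k n).
  by apply: open_measurable; apply: bigcup_open => i _; exact: ball_open.
have mE k : measurable (E k).
  by apply: bigcap_measurable => // n _; exact: measurableU.
have E0 k : lebesgue_measure (E k) = 0%E.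
  apply/eqP; rewrite -measure_le0.
  apply/lee_addgt0Pr => e e_gt0; rewrite add0e.
  pose K : R := 1 + 3 / k.+1%:R^-1.
  have K0 : 0 < K by rewrite addr_gt0// divr_gt0.
  have [N _ Ne] := near_infty_natSinv_lt (PosNum (divr_gt0 e_gt0 K0)).
  apply: (@le_trans _ _ (lebesgue_measure (C N `|` W k N))).
    apply: le_measure; rewrite ?inE.
    - exact: mE.
    - exact: (measurableU _ _ (mC N) (mW k N)).
    - exact: bigcap_inf.
  apply: (le_trans (@measureU2 _ _ _ (@lebesgue_measure R) _ _ (mC N) (mW k N))).
  have [_ lC muC] := CP N.
  apply: (@le_trans _ _ (N.+1%:R^-1%:E + (3 / k.+1%:R^-1)%:E * N.+1%:R^-1%:E)%E).
    rewrite leeD// (le_trans (lebesgue_measure_cover_heavy_balls _ _ _ _ _ _))//.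
    by rewrite lee_wpmul2l// lee_fin divr_ge0.
  rewrite -EFinM -EFinD lee_fin -[X in X + _]mul1r -mulrDl -/K mulrC.
  by rewrite -ler_pdivlMr//; apply/ltW/Ne => /=.
have nE : (@lebesgue_measure R).-negligible (\bigcup_k E k).
  apply: negligible_bigcup => k.
  apply/negligibleP; [exact: mE|exact: E0].
apply: (negligibleS _ nE) => r.
apply: contra_notP => Er.
have dF : (fun h : R => h^-1 *: (F (h *: 1 + r) - F r)) @ 0^' --> (0 : R).
  apply/cvgrPdist_le => e e_gt0.
  have [k _ ke] := near_infty_natSinv_lt (PosNum (divr_gt0 e_gt0 (ltr0n R 4))).
  have {}ke : k.+1%:R^-1 * 4 <= e.
    by rewrite -ler_pdivlMr//; apply/ltW/ke => /=.
  have [n] : exists n, ~ (C n `|` W k n) r.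
    apply/existsNP => H; apply: Er; exists k => // n _; exact: H.
  move=> /not_orP[nC nW].
  have /nbhs_ballP[d /= d0 dC] := open_nbhs_nbhs (conj (oC n) nC).
  (* the ball of radius 2 |h| contains r + h for both signs of h, and its
     Lebesgue measure 4 |h| accounts for the factor 4 *)
  near=> h.
  have h0 : h != 0 by near: h; exact: nbhs_dnbhs_neq.
  have hn0 : 0 < `|h| by rewrite normr_gt0.
  have h2 : 0 < 2 * `|h| by rewrite mulr_gt0.
  have hd : 2 * `|h| <= d.
    rewrite -ler_pdivlMl// mulrC; near: h.
    by apply: dnbhs0_le; rewrite divr_gt0.
  have light : fine (mu (ball r (2 * `|h|))) <= e * `|h|.
    rewrite -lee_fin fineK ?fin_num_measure//; last exact: measurable_ball.
    apply: (@le_trans _ _ (k.+1%:R^-1 * (2 * `|h| *+ 2))%:E); last first.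
      by rewrite lee_fin -mulrnAl mulrA ler_pM2r// -mulrnA.
    rewrite EFinM -(lebesgue_measure_ball r (ltW h2)) leNgt; apply/negP => heavy.
    apply: nW; exists (r, PosNum h2); last exact: ballxx.
    by split => //; apply: subset_trans dC; exact: le_ball.
  rewrite sub0r normrN normrZ normfV ler_pdivrMl// mulrC.
  apply: (le_trans _ light); apply: distribution_function_increment.
    exact: ballxx.
  by rewrite /ball/= scaler1 opprD addrCA subrr addr0 normrN mulr_natl mulr2n ltrDl.
have cF : derivable F r 1 by apply/cvg_ex; exists 0.
split => //; exact: cvg_lim.
Unshelve. all: by end_near.
Qed.
End distribution_function.

(** * Hellinger affinity of product weights *)

Lemma le_geometric_mean (R : realDomainType) (a b s : R) :
  0 <= a -> 0 <= s -> s ^+ 2 = a * b -> a <= b -> a <= s.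
Proof.
move=> a0 s0 sE ab; rewrite -(ler_pXn2r (ltn0Sn 1)) ?nnegrE// sE expr2.
exact: ler_wpM2l.
Qed.

(** Words of length [n] carry the product weight [Q] and the uniform weight
    [2 ^- n]; [affinity] is their Hellinger affinity, which factorises over the
    letters. On either side of the comparison between [Q w] and [2 ^- n], the
    smaller weight is at most the geometric mean [s w], and the geometric means
    add up to the affinity. *)
Section affinity.
Context (R : realType) (n : nat) (q : 'I_n -> bool -> R)
  (q_ge0 : forall i b, 0 <= q i b).

Let Q (w : {ffun 'I_n -> bool}) : R := \prod_(i < n) q i (w i).
Let affinity : R := \prod_(i < n) \sum_(b : bool) Num.sqrt (q i b / 2).

Let s (w : {ffun 'I_n -> bool}) : R := \prod_(i < n) Num.sqrt (q i (w i) / 2).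

Let affinityE : affinity = \sum_w s w.
Proof. by rewrite /affinity bigA_distr_bigA. Qed.

Let s_ge0 w : 0 <= s w. Proof. by apply: prodr_ge0. Qed.
Let Q_ge0 w : 0 <= Q w. Proof. by apply: prodr_ge0. Qed.

Let sE w : s w ^+ 2 = Q w * 2 ^- n.
Proof.
have -> : 2 ^- n = \prod_(i < n) 2^-1 :> R by rewrite prodr_const card_ord exprVn.
rewrite /s -prodrXl /Q -big_split/=.
by apply: eq_bigr => i _; rewrite sqr_sqrtr// divr_ge0.
Qed.

Lemma sum_light_le_affinity : \sum_(w | Q w <= 2 ^- n) Q w <= affinity.
Proof.
rewrite affinityE big_mkcond/=; apply: ler_sum => w _; case: ifPn => // Qw.
exact: (@le_geometric_mean _ _ (2 ^- n)).
Qed.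

Lemma sum_heavy_le_affinity :
  \sum_(w : {ffun 'I_n -> bool} | ~~ (Q w <= 2 ^- n)) 2 ^- n <= affinity.
Proof.
rewrite affinityE big_mkcond/=; apply: ler_sum => w _.
case: ifPn => //; rewrite -ltNge => /ltW Qw.
by apply: (@le_geometric_mean _ _ (Q w)) => //; rewrite sE mulrC.
Qed.
End affinity.

(** With [s] the sum of the two square roots, [s ^+ 2 * (1 - s ^+ 2)] is the square
    of [p - 2^-1], and it is at most [2 * (1 - s)] because [s] lies in [0, 1]. *)
Lemma coin_affinity_le (R : rcfType) (p : R) : 0 <= p <= 1 ->
  0 <= Num.sqrt (p / 2) + Num.sqrt ((1 - p) / 2) <= 1 - (p - 2^-1) ^+ 2 / 2.
Proof.
move=> /andP[p0 p1].
set a := Num.sqrt _; set b := Num.sqrt _.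
have a0 : 0 <= a by exact: sqrtr_ge0.
have b0 : 0 <= b by exact: sqrtr_ge0.
have aE : a ^+ 2 = p / 2 by rewrite sqr_sqrtr// divr_ge0.
have bE : b ^+ 2 = (1 - p) / 2 by rewrite sqr_sqrtr// divr_ge0// subr_ge0.
clearbody a b.
have s0 : 0 <= a + b by rewrite addr_ge0.
rewrite s0/=.
have sq : 1 - (a + b) ^+ 2 = (a - b) ^+ 2.
  have -> : (a - b) ^+ 2 = 2 * (a ^+ 2 + b ^+ 2) - (a + b) ^+ 2 by ring.
  by rewrite aE bE; field.
have s1 : a + b <= 1.
  by rewrite -(ler_pXn2r (ltn0Sn 1)) ?nnegrE// expr1n -subr_ge0 sq sqr_ge0.
have -> : (p - 2^-1) ^+ 2 = (a + b) ^+ 2 * (1 - (a + b) ^+ 2).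
  have -> : p - 2^-1 = a ^+ 2 - b ^+ 2 by rewrite aE bE; field.
  by rewrite sq; ring.
move: (a + b) s0 s1 => s s0 s1; rewrite -subr_ge0.
have -> : 1 - s ^+ 2 * (1 - s ^+ 2) / 2 - s = (1 - s) * (1 - s ^+ 2 * (1 + s) / 2).
  by field.
by rewrite mulr_ge0 ?subr_ge0//; nra.
Qed.

(** Each factor at most [q] improves the bound from [q ^+ k] to [q ^+ k.+1], and
    there is always one further on; the factors in between are at most 1. *)
Lemma prodr_arbitrarily_small (R : archiRealFieldType) (r : nat -> R) (q : R) :
  (forall i, 0 <= r i <= 1) -> q < 1 ->
  (forall N, exists2 i, (N <= i)%N & r i <= q) ->
  forall e, 0 < e -> exists n, \prod_(i < n) r i <= e.
Proof.
move=> r01 q1 rq e e0.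
have r0 i : 0 <= r i by have /andP[] := r01 i.
have r1 i : r i <= 1 by have /andP[] := r01 i.
have q0 : 0 <= q by have [i _] := rq 0%N; exact: le_trans.
have H k : exists n, \prod_(i < n) r i <= q ^+ k.
  elim: k => [|k [n IH]]; first by exists 0%N; rewrite big_ord0.
  have [i ni ri] := rq n; exists i.+1.
  rewrite big_ord_recr/= exprSr ler_pM ?prodr_ge0//.
  apply: le_trans IH; rewrite -!(big_mkord xpredT r) (big_cat_nat (leq0n n) ni)//=.
  by rewrite ler_piMr ?prodr_ge0// prodr_ile1// => j _; rewrite r01.
have /cvgrPdist_le/(_ _ e0)[k _ /(_ k)/= ke] : (fun k => q ^+ k) @ \oo --> (0 : R).
  by apply: cvg_expr; rewrite ger0_norm.
have [n nk] := H k; exists n; apply: (le_trans nk).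
by have := ke (leqnn k); rewrite sub0r normrN ger0_norm ?exprn_ge0.
Qed.

Lemma not_cvg_frequently_far (R : realType) (u : nat -> R) (l : R) :
  ~ (u @ \oo --> l) ->
  exists2 delta : R, 0 < delta &
    forall N, exists2 i, (N <= i)%N & delta <= `|u i - l|.
Proof.
move=> ncv; apply: contrapT => H; apply: ncv; apply/cvgrPdist_lt => e e0.
apply: contrapT => nn; apply: H; exists e => // N.
apply: contrapT => HN; apply: nn; exists N => // i /= Ni.
by rewrite ltNge; apply/negP => ei; apply: HN; exists i => //; rewrite distrC.
Qed.

(** * Biased coins and binary expansions *)

Lemma measure_finType_bigcup_le d (T : measurableType d) (R : realType)
    (mu : {measure set T -> \bar R}) (I : finType) (p : pred I)
    (F : I -> set T) (f : I -> R) :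
  (forall i, p i -> measurable (F i) /\ (mu (F i) <= (f i)%:E)%E) ->
  (mu (\bigcup_(i in [set i | p i]) F i) <= (\sum_(i | p i) f i)%:E)%E.
Proof.
move=> Ff.
have -> : [set i | p i] = [set i | (i \in index_enum I) && p i].
  by apply/seteqP; split=> i /=; rewrite mem_index_enum.
rewrite bigcup_seq_cond.
apply: (big_rec2 (fun (A : set T) (r : R) => measurable A /\ (mu A <= r%:E)%E)
  _ _).2.
  by rewrite measure0.
move=> i A r pi [mA Ar]; have [mF Fr] := Ff _ pi; split; first exact: measurableU.
by apply: (le_trans (measureU2 _ mF mA)); rewrite EFinD leeD.
Qed.

Section binary_expansion.
Context (R : realType) (T : Type) (x : nat -> T -> bool).

Definition binary_prefix n (w : 'I_n -> bool) : R :=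
  \sum_(i < n) (w i)%:R * 2 ^- i.+1.

Lemma binary_sum_prefix n t :
  binary_prefix n (fun i => x i t) <= binary_sum R x t <=
    binary_prefix n (fun i => x i t) + 2 ^- n.
Proof.
set s := binary_prefix _ _.
have cX := @cvg_binary_sum R T x t.
set u := series _ in cX.
have sE : s = u n by rewrite /u /series/= /s /binary_prefix big_mkord.
have u_nd : nondecreasing_seq u.
  apply/nondecreasing_seqP => m; rewrite /u seriesSr/= lerDl.
  by rewrite mulr_ge0// invr_ge0 exprn_ge0.
(* 2 ^- (n + m) is the largest possible sum of the terms after the first n + m;
   keeping track of it makes the induction go through *)
have u_le m : u (n + m)%N <= u n + 2 ^- n - 2 ^- (n + m).
  elim: m => [|m IH]; first by rewrite addn0 addrK.
  rewrite addnS /u seriesSr/= -/u.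
  have -> : 2 ^- (n + m).+1 = 2 ^- (n + m) / 2 :> R by rewrite exprSr invfM mulrC.
  have h : 0 < 2 ^- (n + m) :> R by rewrite invr_gt0 exprn_gt0.
  by case: (x _ t) => /=; lra.
rewrite sE; apply/andP; split.
  rewrite -(cvg_lim (@Rhausdorff R) cX).
  by apply: nondecreasing_cvgn_le => //; apply/cvg_ex; exists (binary_sum R x t).
rewrite -(cvg_lim (@Rhausdorff R) cX); apply: limr_le.
  by apply/cvg_ex; exists (binary_sum R x t).
near=> m; have nm : (n <= m)%N by near: m; exact: nbhs_infty_ge.
rewrite -(subnKC nm); apply: (le_trans (u_le _)).
by rewrite gerDl oppr_le0 invr_ge0 exprn_ge0.
Unshelve. all: by end_near.
Qed.
End binary_expansion.

Section coins.
Context (R : realType) (d : measure_display) (T : measurableType d)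
  (P : probability T R) (x : nat -> {RV P >-> bool}).

Let q i b : R := fine (P (x i @^-1` [set b])).

Lemma measurable_coin i (b : bool) : measurable (x i @^-1` [set b]).
Proof. exact: measurable_funPTI. Qed.

Definition cylinder n (w : 'I_n -> bool) : set T :=
  [set t | forall i : 'I_n, x i t = w i].

Lemma cylinderE n (w : 'I_n -> bool) :
  cylinder n w = \big[setI/setT]_(i < n) (x i @^-1` [set w i]).
Proof.
rewrite -bigcap_seq; apply/seteqP; split=> t /= xw i => [_|]; first exact: xw.
by apply: xw; rewrite /= mem_index_enum.
Qed.

Lemma measurable_cylinder n (w : 'I_n -> bool) : measurable (cylinder n w).
Proof.
rewrite cylinderE; apply: bigsetI_measurable => i _; exact: measurable_coin.
Qed.

Lemma measure_cylinder n (w : 'I_n -> bool) : mutually_independent x ->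
  P (cylinder n w) = (\prod_(i < n) q i (w i))%:E.
Proof.
move=> ind.
pose A i : set bool := if insub i is Some j then [set w j] else setT.
have AE (i : 'I_n) : A i = [set w i] by rewrite /A valK.
have := ind (index_iota 0 n) A (iota_uniq _ _) (fun _ _ => I).
rewrite !big_mkord => PE.
rewrite cylinderE; under eq_bigr do rewrite -AE.
rewrite PE -prodEFin; apply: eq_bigr => i _.
by rewrite AE /q fineK// fin_num_measure//; exact: measurable_coin.
Qed.

Lemma coin_trueE i : q i true = 1 - q i false.
Proof.
rewrite /q -[[set true]](_ : ~` [set false] = _); last first.
  by apply/seteqP; split => -[] //= /(_ erefl).
rewrite -preimage_setC probability_setC; last exact: measurable_coin.
by rewrite fineB// fin_num_measure//; exact: measurable_coin.
Qed.

(** For a suitable [n], call a word heavy if its probability exceeds [2 ^- n]. The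
    closed dyadic intervals of the heavy words form the required set: its
    Lebesgue measure is at most the number of heavy words times [2 ^- n], and the
    random sum falls outside only if the first [n] coins spell a word that is not
    heavy.
    Both quantities are bounded by the affinity, which tends to 0 since infinitely
    many of its factors are at most [1 - delta ^+ 2 / 2]. A point with two
    binary expansions lies in the closed intervals of both, so it causes no
    trouble. *)
Lemma law_nearly_concentrated (delta : R) : mutually_independent x ->
  0 < delta ->
  (forall N, exists2 i, (N <= i)%N & delta <= `|prob0 x i - 2^-1|) ->
  nearly_concentrated (distribution P (binary_RV x)).
Proof.
move=> ind delta0 far e e0.
have q0 i b : 0 <= q i b by exact: fine_ge0.
pose r i := Num.sqrt (prob0 x i / 2) + Num.sqrt ((1 - prob0 x i) / 2).
have r_le i : 0 <= r i <= 1 - (prob0 x i - 2^-1) ^+ 2 / 2.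
  apply: coin_affinity_le; rewrite q0/= -subr_ge0 -/(q i false) -coin_trueE.
  exact: q0.
have [n rn] : exists n, \prod_(i < n) r i <= e.
  apply: (@prodr_arbitrarily_small _ r (1 - delta ^+ 2 / 2)) => //.
  - move=> i; have /andP[-> /le_trans] := r_le i; apply.
    by rewrite gerBl divr_ge0// sqr_ge0.
  - by rewrite ltrBlDr ltrDl divr_gt0// exprn_gt0.
  - move=> N; have [i Ni di] := far N; exists i => //.
    have /andP[_ /le_trans] := r_le i; apply.
    rewrite lerD2l lerN2 ler_pM2r// -[leRHS]real_normK ?num_real//.
    by rewrite ler_pXn2r ?nnegrE// ltW.
have rE : \prod_(i < n) \sum_(b : bool) Num.sqrt (q i b / 2) <= e.
  apply: le_trans rn; rewrite le_eqVlt; apply/orP; left; apply/eqP.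
  by apply: eq_bigr => i _; rewrite big_bool/= coin_trueE addrC.
have qn0 (i : 'I_n) b : 0 <= q i b by [].
pose Q (w : {ffun 'I_n -> bool}) : R := \prod_(i < n) q i (w i).
pose heavy := [set w : {ffun 'I_n -> bool} | ~~ (Q w <= 2 ^- n)].
pose I (w : {ffun 'I_n -> bool}) : set R :=
  [set` `[binary_prefix R n w, binary_prefix R n w + 2 ^- n]].
have cI w : closed (I w) by exact: itv_closed.
have lI w : lebesgue_measure (I w) = (2 ^- n)%:E.
  rewrite lebesgue_measure_itv/= lte_fin ltrDl invr_gt0 exprn_gt0//.
  by rewrite -EFinD addrAC subrr add0r.
have PQ (w : {ffun 'I_n -> bool}) : P (cylinder n w) = (Q w)%:E.
  exact: measure_cylinder.
have cC : closed (\bigcup_(w in heavy) I w).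
  by apply: closed_bigcup => //; exact: finite_finset.
exists (\bigcup_(w in heavy) I w); split.
- exact: cC.
- apply: (@le_trans _ _ (\sum_(w | ~~ (Q w <= 2 ^- n)) 2 ^- n)%:E).
    apply: measure_finType_bigcup_le => w _; split; first exact: closed_measurable.
    by rewrite -(lI w).
  by rewrite lee_fin (le_trans _ rE)// sum_heavy_le_affinity.
- apply: (@le_trans _ _ (\sum_(w | Q w <= 2 ^- n) Q w)%:E); last first.
    by rewrite lee_fin (le_trans _ rE)// sum_light_le_affinity.
  apply: (@le_trans _ _ (P (\bigcup_(w in [set w : {ffun 'I_n -> bool} |
      Q w <= 2 ^- n]) cylinder n w))).
    apply: (@le_measure _ _ _ P); rewrite ?inE.
    + apply: (measurable_funPTI (binary_RV x)); apply: measurableC.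
      exact: closed_measurable.
    + apply: fin_bigcup_measurable; first exact: finite_finset.
      by move=> w _; exact: measurable_cylinder.
    move=> t Xt; pose w : {ffun 'I_n -> bool} := [ffun i : 'I_n => x i t].
    have ws : forall i : 'I_n, x i t = w i by move=> i; rewrite ffunE.
    exists w => //=; apply/negPn/negP => hw; apply: Xt; exists w => //=.
    rewrite /I/= in_itv/= /binary_RV/=.
    have := binary_sum_prefix R T (fun i => x i) n t.
    by rewrite (_ : (fun i : 'I_n => x i t) = w)//; apply/funext.
  apply: measure_finType_bigcup_le => w _.
  by split; [exact: measurable_cylinder|rewrite -PQ].
Qed.

End coins.

Theorem theorem3p4 (R : realType) (d : measure_display) (T : measurableType d)
    (P : probability T R) (x : nat -> {RV P >-> bool}) :
  mutually_independent x ->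
  (forall i, 0 < prob0 x i) ->
  (forall i, prob0 x i != 2^-1) ->
  ~ (prob0 x @ \oo --> (2^-1 : R)) ->
  let F : R -> R := fun r => fine (cdf (binary_RV x) r) in
  {ae @lebesgue_measure R, forall r : R, 0 <= r <= 1 -> is_derive r 1 F 0} /\
  singular_df F.
Proof.
move=> ind _ _ ncv F.
have [delta delta0 far] := not_cvg_frequently_far R (prob0 x) 2^-1 ncv.
pose mu := distribution P (binary_RV x).
have ncmu : nearly_concentrated mu.
  exact: (law_nearly_concentrated R d T P x delta).
split.
  have dF := nearly_concentrated_derivative0 R mu ncmu.
  by apply: (negligibleS _ dF) => r; apply: contra_not => dFr _; exact: dFr.
exists mu; split; last exact: nearly_concentrated_null_carrier.
by move=> r; rewrite /F /cdf fineK// fin_num_measure.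
Qed.
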